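(* (i) $\forall\mathrm{WF}_{\mathbb{N}}$ implies $\exists\mathrm{WF}_{\mathbb{N}}$ constructively (i.e. in intuitionistic logic). (ii) $\exists\mathrm{WF}_{\mathbb{N}}$ implies classically $\forall\mathrm{WF}_{\mathbb{N}}$ and $\mathrm{LNP}$. (iii) $\exists\mathrm{WF}_{\mathbb{N}}$ implies constructively that for every sequence $\alpha \colon \mathbb{N} \to \mathbb{N}$ there is $i \in \mathbb{N}$ with $\alpha(i) \leq \alpha(i+1)$. (iv) The non-existence of an infinite descending sequence in $\mathbb{N}$ implies classically $\exists\mathrm{WF}_{\mathbb{N}}$.
   Context: Setting: Bishop-style constructive mathematics, with the usual equality $=_{\mathbb{N}}$ and order $<$ on $\mathbb{N}$. All formulas $P(x), Q(x)$ on $\mathbb{N}$ below are required to respect $=_{\mathbb{N}}$ (i.e. $x =_{\mathbb{N}} y$ and $P(x)$ imply $P(y)$). The principles are the following schemes. $\exists\mathrm{WF}_{\mathbb{N}}$: for all formulas $P(x), Q(x)$ on $\mathbb{N}$, $$\Big[\exists_{x \in \mathbb{N}} Q(x) \ \&\ \forall_{x \in \mathbb{N}}\Big(Q(x) \Rightarrow \big[P(x) \vee \exists_{y \in \mathbb{N}}(y < x \ \&\ Q(y))\big]\Big)\Big] \Rightarrow \exists_{x \in \mathbb{N}} P(x).$$ $\forall\mathrm{WF}_{\mathbb{N}}$ (transfinite, or strong, induction): for every formula $P(x)$ on $\mathbb{N}$, $$\forall_{x \in \mathbb{N}}\big(\forall_{y < x} P(y) \Rightarrow P(x)\big) \Rightarrow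 \forall_{x \in \mathbb{N}} P(x).$$ $\mathrm{LNP}$ (least number principle): every non-empty subset $A$ of $\mathbb{N}$ has a (unique) least element $\min_A$, i.e. $\min_A \in A$ and $\forall_{x \in \mathbb{N}}(x \in A \Rightarrow \min_A \leq x)$. An infinite descending sequence in $\mathbb{N}$ is a sequence $\alpha \colon \mathbb{N} \to \mathbb{N}$ with $\alpha(n+1) < \alpha(n)$ for every $n \in \mathbb{N}$. *)

(* Defs.v *)
From Stdlib Require Import List.
Import ListNotations.

(** Intuitionistic and classical derivability are kept apart syntactically:
    formulas of arithmetic with number variables and variables for sequences
    [nat -> nat], and natural deduction with or without excluded middle.
    Both sorts of variables are de Bruijn indices, counted independently, so a
    number quantifier does not affect sequence indices, nor conversely. *)

Inductive term : Type :=
| var (n : nat)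
| zero
| succ (t : term)
| add (s t : term)
| mul (s t : term)
| ap (a : nat) (t : term).  (* value at [t] of the sequence variable [a] *)

Inductive form : Type :=
| bot
| eqn (s t : term)
| less (s t : term)
| conj (p q : form)
| disj (p q : form)
| imp (p q : form)
| allN (p : form)
| exN (p : form)
| allS (p : form)
| exS (p : form).

Declare Scope form_scope.
Delimit Scope form_scope with form.
Bind Scope form_scope with form.
Open Scope form_scope.

Notation "s ≈ t" := (eqn s t) (at level 70) : form_scope.
Notation "s ≺ t" := (less s t) (at level 70) : form_scope.
Notation "s ≼ t" := (disj (less s t) (eqn s t)) (at level 70) : form_scope.
Notation "p ∧ q" := (conj p q) (at level 80, right associativity) : form_scope.
Notation "p ∨ q" := (disj p q) (at level 85, right associativity) : form_scope.
Notation "p ⊃ q" := (imp p q) (at level 90, right associativity) : form_scope.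
Notation "¬ p" := (imp p bot) (at level 75, right associativity) : form_scope.

(** Simultaneous substitution: terms for number variables, sequence variables
    for sequence variables. *)

Fixpoint tsubst (f : nat -> term) (g : nat -> nat) (t : term) : term :=
  match t with
  | var n => f n
  | zero => zero
  | succ t => succ (tsubst f g t)
  | add s t => add (tsubst f g s) (tsubst f g t)
  | mul s t => mul (tsubst f g s) (tsubst f g t)
  | ap a t => ap (g a) (tsubst f g t)
  end.

Definition upN (f : nat -> term) (n : nat) : term :=
  match n with
  | 0 => var 0
  | S n => tsubst (fun m => var (S m)) (fun a => a) (f n)
  end.

Definition upS (g : nat -> nat) (a : nat) : nat :=
  match a with
  | 0 => 0
  | S a => S (g a)
  end.

Definition liftS (f : nat -> term) (n : nat) : term := tsubst var S (f n).

Fixpoint subst (f : nat -> term) (g : nat -> nat) (p : form) : form :=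
  match p with
  | bot => bot
  | eqn s t => eqn (tsubst f g s) (tsubst f g t)
  | less s t => less (tsubst f g s) (tsubst f g t)
  | conj p q => conj (subst f g p) (subst f g q)
  | disj p q => disj (subst f g p) (subst f g q)
  | imp p q => imp (subst f g p) (subst f g q)
  | allN p => allN (subst (upN f) g p)
  | exN p => exN (subst (upN f) g p)
  | allS p => allS (subst (liftS f) (upS g) p)
  | exS p => exS (subst (liftS f) (upS g) p)
  end.

(** [inst k l ts p] is [p(ts)] written below [k] number quantifiers and [l]
    sequence quantifiers: the first [length ts] number variables of [p] are its
    arguments and become [ts], all its other variables are parameters and are
    shifted past these quantifiers. *)

Fixpoint args (k : nat) (ts : list term) (n : nat) : term :=
  match ts, n with
  | [], _ => var (k + n)
  | t :: _, 0 => t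
  | _ :: ts, S n => args k ts n
  end.

Definition inst (k l : nat) (ts : list term) (p : form) : form :=
  subst (args k ts) (Nat.add l) p.

Definition instS (b : nat) (p : form) : form :=
  subst var (fun a => match a with 0 => b | S a => a end) p.

Definition theory := form -> Prop.

Definition union (T U : theory) : theory := fun p => T p \/ U p.

Inductive logic : Type := intuitionistic | classical.

(** Free variables of an axiom are implicitly universally quantified, as
    [by_axiom] applies below any shifted context.
    By [eqn_subst] every formula respects equality, so the restriction to
    extensional formulas in the schemes below is automatic. *)

Inductive derives (L : logic) (T : theory) : list form -> form -> Prop :=
| by_hyp G p : In p G -> derives L T G p
| by_axiom G p : T p -> derives L T G p
| bot_elim G p : derives L T G bot -> derives L T G p
| conj_intro G p q :
    derives L T G p -> derives L T G q -> derives L T G (p ∧ q)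
| conj_elim_l G p q : derives L T G (p ∧ q) -> derives L T G p
| conj_elim_r G p q : derives L T G (p ∧ q) -> derives L T G q
| disj_intro_l G p q : derives L T G p -> derives L T G (p ∨ q)
| disj_intro_r G p q : derives L T G q -> derives L T G (p ∨ q)
| disj_elim G p q r :
    derives L T G (p ∨ q) -> derives L T (p :: G) r ->
    derives L T (q :: G) r -> derives L T G r
| imp_intro G p q : derives L T (p :: G) q -> derives L T G (p ⊃ q)
| imp_elim G p q :
    derives L T G (p ⊃ q) -> derives L T G p -> derives L T G q
| allN_intro G p :
    derives L T (map (inst 1 0 []) G) p -> derives L T G (allN p)
| allN_elim G p t : derives L T G (allN p) -> derives L T G (inst 0 0 [t] p)
| exN_intro G p t : derives L T G (inst 0 0 [t] p) -> derives L T G (exN p)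
| exN_elim G p q :
    derives L T G (exN p) ->
    derives L T (p :: map (inst 1 0 []) G) (inst 1 0 [] q) ->
    derives L T G q
| allS_intro G p :
    derives L T (map (inst 0 1 []) G) p -> derives L T G (allS p)
| allS_elim G p b : derives L T G (allS p) -> derives L T G (instS b p)
| exS_intro G p b : derives L T G (instS b p) -> derives L T G (exS p)
| exS_elim G p q :
    derives L T G (exS p) ->
    derives L T (p :: map (inst 0 1 []) G) (inst 0 1 [] q) ->
    derives L T G q
| eqn_refl G t : derives L T G (t ≈ t)
| eqn_subst G p s t :
    derives L T G (s ≈ t) -> derives L T G (inst 0 0 [s] p) ->
    derives L T G (inst 0 0 [t] p)
| excluded_middle G p : L = classical -> derives L T G (p ∨ ¬ p).

Definition implies (L : logic) (T A B : theory) : Prop :=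
  forall p, B p -> derives L (union T A) [] p.

(** Induction is left out on purpose: with it the well-foundedness schemes
    are derivable outright. It may belong to a theory containing these axioms. *)

Inductive arithmetic : theory :=
| succ_neq_zero : arithmetic (allN (¬ succ (var 0) ≈ zero))
| succ_inj :
    arithmetic (allN (allN (succ (var 1) ≈ succ (var 0) ⊃ var 1 ≈ var 0)))
| zero_or_succ :
    arithmetic (allN (var 0 ≈ zero ∨ exN (var 1 ≈ succ (var 0))))
| add_zero : arithmetic (allN (add (var 0) zero ≈ var 0))
| add_succ :
    arithmetic (allN (allN
      (add (var 1) (succ (var 0)) ≈ succ (add (var 1) (var 0)))))
| mul_zero : arithmetic (allN (mul (var 0) zero ≈ zero))
| mul_succ :
    arithmetic (allN (allN
      (mul (var 1) (succ (var 0)) ≈ add (mul (var 1) (var 0)) (var 1))))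
| not_lt_zero : arithmetic (allN (¬ var 0 ≺ zero))
| lt_succ :
    arithmetic (allN (allN
      ((var 1 ≺ succ (var 0) ⊃ var 1 ≼ var 0) ∧
       (var 1 ≼ var 0 ⊃ var 1 ≺ succ (var 0)))))
| lt_irrefl : arithmetic (allN (¬ var 0 ≺ var 0))
| lt_trans :
    arithmetic (allN (allN (allN
      (var 2 ≺ var 1 ⊃ var 1 ≺ var 0 ⊃ var 2 ≺ var 0))))
| lt_total :
    arithmetic (allN (allN
      (var 1 ≺ var 0 ∨ var 1 ≈ var 0 ∨ var 0 ≺ var 1))).

Inductive exists_WF : theory :=
| exists_WF_inst (P Q : form) :
    exists_WF
      (exN (inst 1 0 [var 0] Q) ∧
       allN (inst 1 0 [var 0] Q ⊃
             inst 1 0 [var 0] P ∨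
             exN (var 0 ≺ var 1 ∧ inst 2 0 [var 0] Q))
       ⊃ exN (inst 1 0 [var 0] P)).

Inductive forall_WF : theory :=
| forall_WF_inst (P : form) :
    forall_WF
      (allN (allN (var 0 ≺ var 1 ⊃ inst 2 0 [var 0] P) ⊃ inst 1 0 [var 0] P)
       ⊃ allN (inst 1 0 [var 0] P)).

(** "[var i] is a least element of [A]", below [k] number quantifiers. *)
Definition is_least (k i : nat) (A : form) : form :=
  inst k 0 [var i] A ∧ allN (inst (S k) 0 [var 0] A ⊃ var (S i) ≼ var 0).

(** Subsets of the natural numbers are given by formulas; non-empty means
    inhabited. *)
Inductive LNP : theory :=
| LNP_inst (A : form) :
    LNP
      (exN (inst 1 0 [var 0] A)
       ⊃ exN (is_least 1 0 A ∧ allN (is_least 2 0 A ⊃ var 0 ≈ var 1))).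

Inductive every_sequence_has_non_descent : theory :=
| every_sequence_has_non_descent_ax :
    every_sequence_has_non_descent
      (allS (exN (ap 0 (var 0) ≼ ap 0 (succ (var 0))))).

Inductive no_infinite_descending_sequence : theory :=
| no_infinite_descending_sequence_ax :
    no_infinite_descending_sequence
      (¬ exS (allN (ap 0 (succ (var 0)) ≺ ap 0 (var 0)))).

(** Relativized dependent choice for numbers: if every [x] with [Q(x)] has a
    [y] with [Q(y)] and [R(x,y)], then every [x] with [Q(x)] starts a sequence
    in [Q] whose consecutive values are related by [R]. *)
Inductive dependent_choice : theory :=
| dependent_choice_inst (Q R : form) :
    dependent_choice
      (allN (inst 1 0 [var 0] Q ⊃
             exN (inst 2 0 [var 0] Q ∧ inst 2 0 [var 1; var 0] R))
       ⊃ allN (inst 1 0 [var 0] Q ⊃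
               exS (ap 0 zero ≈ var 0 ∧
                    allN (inst 2 1 [ap 0 (var 0)] Q ∧
                          inst 2 1 [ap 0 (var 0); ap 0 (succ (var 0))] R)))).

(* Main.v *)
Require Import Defs.
From Stdlib Require Import List.
Import ListNotations.

(** Intuitionistically, [∃WF] follows from transfinite induction on the formula
    [Q(x) ⊃ ∃z P(z)]: given [Q(x)], either [P(x)] holds, or the induction
    hypothesis applies to a smaller [y] with [Q(y)] ([forall_WF_exists_WF]).

    For the converse, let [P] be progressive and suppose that some [x] violates
    it. Classically, a violation has a smaller violation, for otherwise
    progressiveness would give [P(x)]. So [∃WF] with [Q := ¬P] and with falsity
    in the place of [P] refutes the existence of violations
    ([exists_WF_forall_WF]). A least element of [A] comes from [∃WF] with
    [Q := A] and with being least in [A] as the goal: an element of [A] without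
    a smaller one in [A] is least, by totality of the order ([exists_WF_LNP]).

    For sequences, [∃WF] is applied to the range of [α], with the existence of
    a non-descent of [α] as the goal: comparing [α(n)] with [α(n+1)] yields
    either the goal or an element of the range smaller than [α(n)]
    ([exists_WF_non_descent]).

    Finally, if no [x] satisfies [P], then the premise of [∃WF] puts below every
    [x] with [Q(x)] a smaller [y] with [Q(y)], and dependent choice strings
    such elements together to an infinite descending sequence
    ([no_infinite_descent_exists_WF]).

    These arguments become derivations once each well-foundedness scheme is a
    rule that works below an arbitrary context ([exists_WF_rule],
    [forall_WF_rule]). The instances of one formula that meet in a derivation
    differ by nested substitutions; these are fused ([subst_subst]) and then
    compared variable by variable ([subst_ext]). *)

(** * Substitution calculus *)

Lemma tsubst_ext f g f' g' t :
  (forall n, f n = f' n) -> (forall a, g a = g' a) ->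
  tsubst f g t = tsubst f' g' t.
Proof. intros hf hg; induction t; cbn; congruence. Qed.

Lemma tsubst_tsubst f g f' g' t :
  tsubst f g (tsubst f' g' t) =
  tsubst (fun n => tsubst f g (f' n)) (fun a => g (g' a)) t.
Proof. induction t; cbn; congruence. Qed.

Lemma tsubst_id f g t :
  (forall n, f n = var n) -> (forall a, g a = a) -> tsubst f g t = t.
Proof. intros hf hg; induction t; cbn; congruence. Qed.

Lemma upN_ext f f' :
  (forall n, f n = f' n) -> forall n, upN f n = upN f' n.
Proof. intros h [|n]; cbn; now rewrite ?h. Qed.

Lemma upS_ext g g' :
  (forall a, g a = g' a) -> forall a, upS g a = upS g' a.
Proof. intros h [|a]; cbn; now rewrite ?h. Qed.

Lemma liftS_ext f f' :
  (forall n, f n = f' n) -> forall n, liftS f n = liftS f' n.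
Proof. intros h n; unfold liftS; now rewrite h. Qed.

Lemma subst_ext f g f' g' p :
  (forall n, f n = f' n) -> (forall a, g a = g' a) ->
  subst f g p = subst f' g' p.
Proof.
  revert f g f' g'; induction p; intros f g f' g' hf hg; cbn; f_equal;
    auto using tsubst_ext, upN_ext, upS_ext, liftS_ext.
Qed.

Lemma upN_subst f g f' n :
  tsubst (upN f) g (upN f' n) = upN (fun m => tsubst f g (f' m)) n.
Proof.
  destruct n as [|n]; [reflexivity|]; cbn; rewrite !tsubst_tsubst.
  now apply tsubst_ext.
Qed.

Lemma liftS_subst f g f' n :
  tsubst (liftS f) (upS g) (liftS f' n) = liftS (fun m => tsubst f g (f' m)) n.
Proof. unfold liftS; rewrite !tsubst_tsubst; now apply tsubst_ext. Qed.

Lemma upS_comp g g' a : upS g (upS g' a) = upS (fun b => g (g' b)) a.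
Proof. now destruct a. Qed.

Lemma subst_subst f g f' g' p :
  subst f g (subst f' g' p) =
  subst (fun n => tsubst f g (f' n)) (fun a => g (g' a)) p.
Proof.
  revert f g f' g'; induction p; intros f g f' g'; cbn;
    rewrite ?tsubst_tsubst; f_equal; auto.
  1, 2: rewrite IHp; apply subst_ext; auto using upN_subst.
  1, 2: rewrite IHp; apply subst_ext; auto using liftS_subst, upS_comp.
Qed.

Lemma subst_id f g p :
  (forall n, f n = var n) -> (forall a, g a = a) -> subst f g p = p.
Proof.
  revert f g; induction p; intros f g hf hg; cbn; f_equal;
    auto using tsubst_id.
  1, 2: apply IHp; [intros [|n]; cbn; now rewrite ?hf | assumption].
  1, 2: apply IHp; [intros n; unfold liftS; now rewrite hf
                   | intros [|a]; cbn; now rewrite ?hg].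
Qed.

(** Four number variables are compared one by one: no substitution below treats
    more of them specially. *)
Ltac vars_eq :=
  let n := fresh "n" in
  intro n; cbn; try reflexivity;
  do 4 (destruct n as [|n]; cbn; try reflexivity).

Ltac subst_eq_leaf :=
  lazymatch goal with
  | |- ?x = ?x => reflexivity
  | |- subst _ _ ?p = ?p => apply subst_id; vars_eq
  | |- ?p = subst _ _ ?p => symmetry; apply subst_id; vars_eq
  | |- subst _ _ ?p = subst _ _ ?p => apply subst_ext; vars_eq
  | |- tsubst _ _ ?t = ?t => apply tsubst_id; vars_eq
  | |- ?t = tsubst _ _ ?t => symmetry; apply tsubst_id; vars_eq
  | |- tsubst _ _ ?t = tsubst _ _ ?t => apply tsubst_ext; vars_eq
  end.

(** Fusing first leaves a single substitution on each side of every schematic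
    formula or term, and these can be compared pointwise. *)
Ltac subst_eq :=
  unfold is_least, inst, instS;
  cbn -[Nat.add]; rewrite ?subst_subst, ?tsubst_tsubst; cbn;
  repeat (first [subst_eq_leaf | progress f_equal]).

(** * Derived rules *)

Lemma derives_mono L L' T T' G G' p :
  (L = classical -> L' = classical) -> (forall q, T q -> T' q) ->
  incl G G' -> derives L T G p -> derives L' T' G' p.
Proof.
  intros hL hT hG d; revert G' hG.
  assert (cons_mono : forall (q : form) H H', incl H H' -> incl (q :: H) (q :: H')).
  { intros q H H' h; apply incl_cons; [apply in_eq | now apply incl_tl]. }
  induction d; intros G' hG; try solve [econstructor; eauto using incl_map].
Qed.

Lemma derives_lift L L' T A G p :
  (L = classical -> L' = classical) ->
  derives L T [] p -> derives L' (union T A) G p.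
Proof.
  intros hL; apply derives_mono; [exact hL | now left | apply incl_nil_l].
Qed.

Lemma hyp_at n L T G p q : nth_error G n = Some q -> q = p -> derives L T G p.
Proof. intros h <-; apply by_hyp; now apply nth_error_In with n. Qed.

(** Quantifier rules leave shifts on the context, so that a hypothesis matches
    the goal only up to substitutions. When the goal is not yet determined, the
    shape of a hypothesis may fill it in. *)
Ltac hyp :=
  cbn [map];
  first
    [ apply (hyp_at 0) with (1 := eq_refl); solve [subst_eq]
    | apply (hyp_at 1) with (1 := eq_refl); solve [subst_eq]
    | apply (hyp_at 2) with (1 := eq_refl); solve [subst_eq]
    | apply (hyp_at 3) with (1 := eq_refl); solve [subst_eq]
    | apply (hyp_at 4) with (1 := eq_refl); solve [subst_eq]
    | apply (hyp_at 5) with (1 := eq_refl); solve [subst_eq] ].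

Lemma derives_eq L T G p q : derives L T G p -> p = q -> derives L T G q.
Proof. now intros d <-. Qed.

Lemma allN_elim_eq t p q L T G :
  derives L T G (allN p) -> inst 0 0 [t] p = q -> derives L T G q.
Proof. intros d <-; now apply allN_elim. Qed.

Lemma exN_intro_eq t q L T G p :
  inst 0 0 [t] p = q -> derives L T G q -> derives L T G (exN p).
Proof. intros <-; apply exN_intro. Qed.

Lemma exN_elim_eq p q' L T G q :
  derives L T G (exN p) -> inst 1 0 [] q = q' ->
  derives L T (p :: map (inst 1 0 []) G) q' -> derives L T G q.
Proof. intros d <-; now apply exN_elim. Qed.

Lemma not_elim p L T G :
  derives L T G (¬ p) -> derives L T G p -> derives L T G bot.
Proof. apply imp_elim. Qed.

Lemma cut p L T G q :
  derives L T G p -> derives L T (p :: G) q -> derives L T G q.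
Proof. intros d e; apply imp_elim with p; [now apply imp_intro | assumption]. Qed.

Lemma by_cases p L T G q :
  L = classical ->
  derives L T (p :: G) q -> derives L T ((¬ p) :: G) q -> derives L T G q.
Proof. intros hL; apply disj_elim; now apply excluded_middle. Qed.

Lemma by_contradiction L T G p :
  L = classical -> derives L T ((¬ p) :: G) bot -> derives L T G p.
Proof.
  intros hL d; apply (by_cases p); [assumption | hyp | now apply bot_elim].
Qed.

Lemma eqn_sym L T G s t : derives L T G (s ≈ t) -> derives L T G (t ≈ s).
Proof.
  intros d.
  apply derives_eq with
    (inst 0 0 [t] (var 0 ≈ tsubst (fun n => var (S n)) (fun a => a) s));
    [|subst_eq].
  apply eqn_subst with s; [assumption|].
  apply derives_eq with (s ≈ s); [apply eqn_refl | subst_eq].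
Qed.

Lemma less_eqn_r L T G r s t :
  derives L T G (r ≺ s) -> derives L T G (s ≈ t) -> derives L T G (r ≺ t).
Proof.
  intros d e.
  apply derives_eq with
    (inst 0 0 [t] (tsubst (fun n => var (S n)) (fun a => a) r ≺ var 0));
    [|subst_eq].
  apply eqn_subst with s; [assumption|].
  apply derives_eq with (1 := d); subst_eq.
Qed.

(** * Order axioms for arbitrary terms *)

(** Asking for derivability in [L] itself, below every context, lets one lemma
    serve the intuitionistic and the classical results. *)
Definition has_arithmetic (L : logic) (T : theory) : Prop :=
  forall G p, arithmetic p -> derives L T G p.

Lemma less_total s t L T G :
  has_arithmetic L T -> derives L T G (s ≺ t ∨ s ≈ t ∨ t ≺ s).
Proof.
  intros ar; eapply (allN_elim_eq t); [eapply (allN_elim_eq s)|].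
  - apply ar, lt_total.
  - reflexivity.
  - subst_eq.
Qed.

Lemma less_asym L T G s t :
  has_arithmetic L T ->
  derives L T G (s ≺ t) -> derives L T G (t ≺ s) -> derives L T G bot.
Proof.
  intros ar d e; apply (not_elim (s ≺ s)).
  - eapply (allN_elim_eq s); [apply ar, lt_irrefl | subst_eq].
  - apply imp_elim with (t ≺ s); [|assumption].
    apply imp_elim with (s ≺ t); [|assumption].
    eapply (allN_elim_eq s); [eapply (allN_elim_eq t);
      [eapply (allN_elim_eq s)|]|].
    + apply ar, lt_trans.
    + reflexivity.
    + reflexivity.
    + subst_eq.
Qed.

Lemma leq_antisym L T G s t :
  has_arithmetic L T ->
  derives L T G (s ≼ t) -> derives L T G (t ≼ s) -> derives L T G (s ≈ t).
Proof.
  intros ar d e; apply disj_elim with (1 := d); [|hyp].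
  apply disj_elim with (t ≺ s) (t ≈ s).
  - apply derives_mono with (4 := e); auto using incl_tl, incl_refl.
  - apply bot_elim, (less_asym _ _ _ s t); [assumption | hyp | hyp].
  - apply eqn_sym; hyp.
Qed.

(** * The schemes as rules *)

Lemma inst_self p : inst 1 0 [var 0] p = p.
Proof. subst_eq. Qed.

Lemma exists_WF_rule Q P L T G :
  (forall p, exists_WF p -> T p) ->
  derives L T G (exN Q) ->
  derives L T (Q :: map (inst 1 0 []) G)
    (P ∨ exN (var 0 ≺ var 1 ∧ inst 2 0 [var 0] Q)) ->
  derives L T G (exN P).
Proof.
  intros wf e d.
  pose proof (exists_WF_inst P Q) as a; rewrite !inst_self in a.
  eapply imp_elim; [apply by_axiom, wf, a|].
  apply conj_intro; [assumption|].
  now apply allN_intro, imp_intro.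
Qed.

Lemma forall_WF_rule P L T G :
  (forall p, forall_WF p -> T p) ->
  derives L T (allN (var 0 ≺ var 1 ⊃ inst 2 0 [var 0] P) :: map (inst 1 0 []) G)
    P ->
  derives L T G (allN P).
Proof.
  intros wf d.
  pose proof (forall_WF_inst P) as a; rewrite !inst_self in a.
  eapply imp_elim; [apply by_axiom, wf, a|].
  now apply allN_intro, imp_intro.
Qed.

Lemma exists_WF_intro L T :
  (forall P Q,
     derives L T
       [exN Q ∧ allN (Q ⊃ P ∨ exN (var 0 ≺ var 1 ∧ inst 2 0 [var 0] Q))]
       (exN P)) ->
  forall p, exists_WF p -> derives L T [] p.
Proof. intros h p [P Q]; rewrite !inst_self; apply imp_intro, h. Qed.

Lemma forall_WF_intro L T :
  (forall P,
     derives L T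
       [allN (allN (var 0 ≺ var 1 ⊃ inst 2 0 [var 0] P) ⊃ P)] (allN P)) ->
  forall p, forall_WF p -> derives L T [] p.
Proof. intros h p [P]; rewrite !inst_self; apply imp_intro, h. Qed.

(** * The four implications *)

(** Induction on [Q(x) ⊃ ∃z P(z)]: keeping [Q(x)] inside the induction formula
    is what allows the induction hypothesis to be used at the smaller [y]. *)
Lemma forall_WF_exists_WF L T :
  (forall p, forall_WF p -> T p) ->
  forall p, exists_WF p -> derives L T [] p.
Proof.
  intros wf; apply exists_WF_intro; intros P Q.
  apply (cut (allN (Q ⊃ exN (inst 2 0 [var 0] P)))).
  - apply forall_WF_rule, imp_intro; [assumption|].
    apply disj_elim with P (exN (var 0 ≺ var 1 ∧ inst 2 0 [var 0] Q)).
    + apply imp_elim with Q; [|hyp].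
      eapply (allN_elim_eq (var 0)); [eapply conj_elim_r; hyp | subst_eq].
    + apply (exN_intro_eq (var 0) P); [subst_eq | hyp].
    + eapply exN_elim_eq; [hyp | reflexivity |].
      apply imp_elim with (inst 2 0 [var 0] Q); [|eapply conj_elim_r; hyp].
      apply imp_elim with (var 0 ≺ var 1); [|eapply conj_elim_l; hyp].
      eapply (allN_elim_eq (var 0)); [hyp | subst_eq].
  - eapply exN_elim_eq; [eapply conj_elim_l; hyp | reflexivity |].
    apply imp_elim with Q; [|hyp].
    eapply (allN_elim_eq (var 0)); [hyp | subst_eq].
Qed.

(** [∃WF] with falsity as the goal says that a property whose instances all have
    smaller ones has no instance. The counterexamples to a progressive formula
    form such a property. *)
Lemma exists_WF_forall_WF T :
  (forall p, exists_WF p -> T p) ->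
  forall p, forall_WF p -> derives classical T [] p.
Proof.
  intros wf; apply forall_WF_intro; intros P.
  apply (by_cases (exN (¬ P))); [reflexivity | |].
  - apply bot_elim.
    apply (exN_elim_eq bot bot); [|reflexivity | hyp].
    apply exists_WF_rule with (¬ P); [assumption | hyp |].
    apply (by_cases (exN (var 0 ≺ var 1 ∧ ¬ inst 2 0 [var 0] P)));
      [reflexivity | |].
    + apply disj_intro_r; hyp.
    + apply bot_elim, (not_elim P); [hyp|].
      apply imp_elim with (allN (var 0 ≺ var 1 ⊃ inst 2 0 [var 0] P)).
      * eapply (allN_elim_eq (var 0)); [hyp | subst_eq].
      * apply allN_intro, imp_intro, by_contradiction; [reflexivity|].
        apply (not_elim (exN (var 0 ≺ var 2 ∧ ¬ inst 3 0 [var 0] P))); [hyp|].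
        apply (exN_intro_eq (var 0) (var 0 ≺ var 1 ∧ ¬ inst 2 0 [var 0] P));
          [subst_eq|].
        apply conj_intro; hyp.
  - apply allN_intro, by_contradiction; [reflexivity|].
    apply (not_elim (exN (¬ inst 2 0 [var 0] P))); [hyp|].
    apply (exN_intro_eq (var 0) (¬ P)); [subst_eq | hyp].
Qed.

Lemma least_leq k i t A L T G :
  derives L T G (is_least k i A) -> derives L T G (inst k 0 [t] A) ->
  derives L T G (var i ≼ t).
Proof.
  intros l d; apply imp_elim with (2 := d).
  eapply (allN_elim_eq t); [eapply conj_elim_r, l | subst_eq].
Qed.

(** An element of [A] with no smaller one in [A] is least, and every element
    that is not least has a smaller one; this is the premise of [∃WF]. *)
Lemma exists_WF_LNP T :
  has_arithmetic classical T -> (forall p, exists_WF p -> T p) ->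
  forall p, LNP p -> derives classical T [] p.
Proof.
  intros ar wf p [A]; rewrite inst_self; apply imp_intro.
  apply (exN_elim_eq (is_least 1 0 A)
           (exN (is_least 2 0 A ∧ allN (is_least 3 0 A ⊃ var 0 ≈ var 1))));
    [|subst_eq|].
  - apply exists_WF_rule with A; [assumption | hyp |].
    apply (by_cases (exN (var 0 ≺ var 1 ∧ inst 2 0 [var 0] A)));
      [reflexivity | |].
    + apply disj_intro_r; hyp.
    + apply disj_intro_l, conj_intro; [hyp|].
      apply allN_intro, imp_intro.
      eapply disj_elim; [now apply (less_total (var 1) (var 0)) | |].
      * apply disj_intro_l; hyp.
      * eapply disj_elim; [hyp | apply disj_intro_r; hyp |].
        apply bot_elim, (not_elim (exN (var 0 ≺ var 2 ∧ inst 3 0 [var 0] A)));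
          [hyp|].
        apply (exN_intro_eq (var 0) (var 0 ≺ var 1 ∧ inst 2 0 [var 0] A));
          [subst_eq|].
        apply conj_intro; hyp.
  - apply (exN_intro_eq (var 0)
             (is_least 1 0 A ∧ allN (is_least 2 0 A ⊃ var 0 ≈ var 1)));
      [subst_eq|].
    apply conj_intro; [hyp|].
    apply allN_intro, imp_intro, leq_antisym; [assumption | |].
    + apply least_leq with 2 A; [hyp|].
      eapply conj_elim_l, (derives_eq _ _ _ (is_least 2 1 A)); [hyp | reflexivity].
    + apply least_leq with 2 A; [hyp|].
      eapply conj_elim_l, (derives_eq _ _ _ (is_least 2 0 A)); [hyp | reflexivity].
Qed.

(** [∃WF] for the range of the sequence. The existence of a non-descent does not
    depend on the point of the range from which it is reached, so it serves as the
    goal formula as it stands. *)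
Lemma exists_WF_non_descent L T :
  has_arithmetic L T -> (forall p, exists_WF p -> T p) ->
  forall p, every_sequence_has_non_descent p -> derives L T [] p.
Proof.
  intros ar wf p []; apply allS_intro.
  set (C := exN (ap 0 (var 0) ≼ ap 0 (succ (var 0)))).
  apply (exN_elim_eq C C); [|reflexivity | hyp].
  apply exists_WF_rule with (exN (var 1 ≈ ap 0 (var 0))); [assumption | |].
  - apply (exN_intro_eq (ap 0 zero) (exN (ap 0 zero ≈ ap 0 (var 0)))).
    + reflexivity.
    + apply (exN_intro_eq zero (ap 0 zero ≈ ap 0 zero)); [reflexivity|].
      apply eqn_refl.
  - eapply exN_elim_eq; [hyp | reflexivity |].
    apply disj_elim with (ap 0 (var 0) ≼ ap 0 (succ (var 0)))
                         (ap 0 (succ (var 0)) ≺ ap 0 (var 0)).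
    + eapply disj_elim;
        [now apply (less_total (ap 0 (var 0)) (ap 0 (succ (var 0)))) | |].
      * apply disj_intro_l, disj_intro_l; hyp.
      * eapply disj_elim; [hyp | |].
        -- apply disj_intro_l, disj_intro_r; hyp.
        -- apply disj_intro_r; hyp.
    + apply disj_intro_l.
      eapply (exN_intro_eq (var 0)); [reflexivity | hyp].
    + apply disj_intro_r.
      eapply (exN_intro_eq (ap 0 (succ (var 0)))); [reflexivity|].
      apply conj_intro.
      * apply less_eqn_r with (ap 0 (var 0)); [hyp | apply eqn_sym; hyp].
      * eapply (exN_intro_eq (succ (var 0))); [reflexivity | apply eqn_refl].
Qed.

(** If [P] has no instance, then below every instance of [Q] lies another
    one, and dependent choice for [y ≺ x] on [Q] descends forever. *)
Lemma no_infinite_descent_exists_WF T :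
  (forall G p, dependent_choice p -> derives classical T G p) ->
  (forall p, no_infinite_descending_sequence p -> T p) ->
  forall p, exists_WF p -> derives classical T [] p.
Proof.
  intros dc nd; apply exists_WF_intro; intros P Q.
  apply by_contradiction; [reflexivity|].
  apply (cut (allN (Q ⊃ exN (inst 2 0 [var 0] Q ∧ var 0 ≺ var 1)))).
  - apply allN_intro, imp_intro.
    apply disj_elim with P (exN (var 0 ≺ var 1 ∧ inst 2 0 [var 0] Q)).
    + apply imp_elim with Q; [|hyp].
      eapply (allN_elim_eq (var 0)); [eapply conj_elim_r; hyp | subst_eq].
    + apply bot_elim, (not_elim (exN (inst 2 0 [var 0] P))); [hyp|].
      apply (exN_intro_eq (var 0) P); [subst_eq | hyp].
    + eapply exN_elim_eq; [hyp | reflexivity |].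
      apply (exN_intro_eq (var 0) (inst 2 0 [var 0] Q ∧ var 0 ≺ var 1));
        [subst_eq|].
      apply conj_intro; [eapply conj_elim_r | eapply conj_elim_l]; hyp.
  - (* The relation of dependent choice takes the current value first, then
       the next one. *)
    pose proof (dependent_choice_inst Q (var 1 ≺ var 0)) as choice.
    rewrite inst_self in choice.
    eapply cut; [eapply imp_elim; [now apply dc, choice | hyp]|].
    apply (exN_elim_eq Q bot); [eapply conj_elim_l; hyp | reflexivity |].
    eapply not_elim; [apply by_axiom, nd; constructor|].
    eapply exS_elim.
    + apply imp_elim with Q; [|hyp].
      eapply (allN_elim_eq (var 0)); [hyp|].
      apply (f_equal2 imp); [subst_eq | reflexivity].
    + apply (exS_intro _ _ _ _ 0), allN_intro.
      eapply conj_elim_r, (allN_elim_eq (var 0));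
        [eapply conj_elim_r; hyp | subst_eq].
Qed.

Theorem proposition3p1 (T : theory) (hT : forall p : form, arithmetic p -> derives intuitionistic T nil p) :
  implies intuitionistic T forall_WF exists_WF /\
  (implies classical T exists_WF forall_WF /\ implies classical T exists_WF LNP) /\
  implies intuitionistic T exists_WF every_sequence_has_non_descent /\
  ((forall p : form, dependent_choice p -> derives classical T nil p) ->
   implies classical T no_infinite_descending_sequence exists_WF).
Proof.
  assert (ar : forall L A, has_arithmetic L (union T A)).
  { intros L A G p hp; apply derives_lift with intuitionistic; auto; discriminate. }
  assert (right : forall (A : theory) p, A p -> union T A p) by now right.
  repeat split; unfold implies.
  - apply forall_WF_exists_WF, right.
  - apply exists_WF_forall_WF, right.
  - apply exists_WF_LNP; [apply ar | apply right].
  - apply exists_WF_non_descent; [apply ar | apply right].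
  - intros dc; apply no_infinite_descent_exists_WF; [|apply right].
    intros G p hp; apply derives_lift with classical; auto.
Qed.
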